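(* Let $w=(p,q)\in\mathbb R_{>0}^2$, let $0<r<1$, and put $s=\log(1/r)$. Then $$F_\mu^0(r^p,r^q)=r^{-\mathcal H_\mu(w)}\Lambda_{\mu,w}(s).$$ Moreover, $\lim_{s\to\infty}\Lambda_{\mu,w}(s)=\mu(E_w)$.
   Context: Let $\mu$ be a finite nonzero positive Radon measure with compact support $E=\operatorname{supp}\mu\subset\mathbb R_{\ge0}^2$, and for $x,y>0$ let $F_\mu^0(x,y)=\int_E x^{-\alpha_1}y^{-\alpha_2}\,d\mu(\alpha)$. For $w=(p,q)\in\mathbb R_{>0}^2$ put $\mathcal H_\mu(w)=\max_{\alpha\in E}(p\alpha_1+q\alpha_2)$, $E_w=\{\alpha\in E:\langle w,\alpha\rangle=\mathcal H_\mu(w)\}$ (the exposed face), $\Delta_w(\alpha)=\mathcal H_\mu(w)-\langle w,\alpha\rangle\ge0$, and $\Lambda_{\mu,w}(s)=\int_E e^{-s\Delta_w(\alpha)}\,d\mu(\alpha)$ for $s\ge0$. *)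

(* Defs.v *)
From HB Require Import structures.
From mathcomp Require Import all_boot all_order all_algebra.
From mathcomp Require Import all_classical all_reals all_analysis.
From mathcomp Require Import measurable_realfun.

Set Implicit Arguments.
Unset Strict Implicit.
Unset Printing Implicit Defensive.

Import Order.TTheory GRing.Theory Num.Theory.
Import numFieldNormedType.Exports.

Local Open Scope classical_set_scope.
Local Open Scope ring_scope.

Section definitions.
Context {R : realType}.
Implicit Types (mu : {measure set (R * R)%type -> \bar R}) (w a : R * R).

(* The measurable sets of [R * R] are those of the product sigma-algebra, which
   is the Borel sigma-algebra of the plane (lemma [measurable_planeE]). *)
Definition radon mu :=
  (forall K : set (R * R), compact K -> (mu K < +oo)%E) /\
  (forall A : set (R * R), measurable A ->
     mu A = ereal_sup [set mu K | K in [set K | compact K /\ K `<=` A]]).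

Definition supp mu : set (R * R) :=
  [set a | forall U : set (R * R), open U -> U a -> (0 < mu U)%E].

Definition dot w a : R := w.1 * a.1 + w.2 * a.2.

Definition F0 mu (x y : R) : \bar R :=
  (\int[mu]_(a in supp mu) (x `^ (- a.1) * y `^ (- a.2))%:E)%E.

(* When the support is compact and nonempty this supremum is attained (lemma
   [Hmax_attained]), so that it is a maximum. *)
Definition Hmax mu w : R := sup [set dot w a | a in supp mu].

Definition exposed_face mu w : set (R * R) :=
  [set a | supp mu a /\ dot w a = Hmax mu w].

Definition Delta mu w a : R := Hmax mu w - dot w a.

Definition Lambda mu w (s : R) : \bar R :=
  (\int[mu]_(a in supp mu) (expR (- (s * Delta mu w a)))%:E)%E.

End definitions.

Section facts.
Context {R : realType}.

Lemma open_measurable_plane (U : set (R * R)) : open U -> measurable U.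
Proof.
move=> oU.
pose box (t : (rat * rat) * (rat * rat)) : set (R * R) :=
  ball (ratr t.1.1 : R) (ratr t.1.2 : R) `*` ball (ratr t.2.1 : R) (ratr t.2.2 : R).
have -> : U = \bigcup_(t in [set t | box t `<=` U]) box t.
  apply/seteqP; split=> [[x y] Uxy|z [t tU]]; last exact: tU.
  have : nbhs (x, y) U by exact: open_nbhs_nbhs.
  move=> [[A B] /= [/nbhs_interior nA /nbhs_interior nB]] ABU.
  have [c [r [xc cA]]] :=
    open_subball_rat (open_interior A) (mem_set (nbhs_singleton nA)).
  have [d [q [yd dB]]] :=
    open_subball_rat (open_interior B) (mem_set (nbhs_singleton nB)).
  exists ((c, r), (d, q)) => /=; last first.
    by split; rewrite /=; apply/set_mem.
  move=> [u v] [/= /cA uA /dB vB]; apply: ABU; split => /=.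
    exact: (interior_subset uA).
  exact: (interior_subset vB).
rewrite bigcup_mkcond; apply: countable_bigcupT_measurable => //= t.
case: ifPn => // _; apply: measurableX; apply: open_measurable; exact: ball_open.
Qed.

Lemma measurable_planeE :
  (measurable : set (set (R * R))) = <<s @open (R * R)%type >>.
Proof.
apply/seteqP; split; last first.
  by apply: smallest_sub; [exact: sigma_algebra_measurable|
                           exact: open_measurable_plane].
have gen (f : R * R -> R) : continuous f -> forall A : set R, measurable A ->
    <<s @open (R * R)%type >> (f @^-1` A).
  move=> cf; have : (measurable : set (set R)) `<=`
      [set A | <<s @open (R * R)%type >> (f @^-1` A)].
    rewrite [X in X `<=` _](@RGenOpens.measurableE R).
    apply: smallest_sub.
      have [s0 sD sU] := smallest_sigma_algebra setT (@open (R * R)%type).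
      split; first by rewrite /= preimage_set0.
      - by move=> A /= /sD; rewrite !setTD -preimage_setC.
      - by move=> F /= /sU; rewrite preimage_bigcup.
    move=> _ [x [y ->]]; apply: sub_gen_smallest.
    by apply: open_comp => [z _|]; [exact: cf|exact: interval_open].
  exact.
apply: smallest_sub; first exact: smallest_sigma_algebra.
move=> _ [] [A mA <-]; rewrite setTI; apply: gen mA.
- by move=> z; exact: cvg_fst.
- by move=> z; exact: cvg_snd.
Qed.

Lemma supp_neq0 (mu : {measure set (R * R)%type -> \bar R}) :
  radon mu -> (0 < mu setT)%E -> supp mu !=set0.
Proof.
move=> [_ inner] mu0; apply/set0P/eqP => E0.
suff : (mu setT <= 0)%E by rewrite leNgt mu0.
rewrite (inner setT)//; apply: ge_ereal_sup => _ [K [cK _] <-].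
have nullU (a : R * R) : exists U : set (R * R), [/\ open U, U a & mu U = 0%E].
  have : ~ supp mu a by rewrite E0.
  move=> /existsNP[U /not_implyP[oU /not_implyP[Ua /negP]]].
  by rewrite -leNgt measure_le0 => /eqP U0; exists U.
pose V a := projT1 (cid (nullU a)).
have VP a : [/\ open (V a), V a a & mu (V a) = 0%E] := projT2 (cid (nullU a)).
pose P : ptopologicalType :=
  HB.pack (R * R)%type (Pointed.on (R * R)%type) (Topological.on (R * R)%type).
have : @cover_compact P K by rewrite -(@compact_cover P).
move=> /(_ _ setT V).
case=> [a _|a _|D _ KD]; first by have [] := VP a.
  by exists a => //; have [] := VP a.
have mV a : measurable (V a) by apply: open_measurable_plane; have [] := VP a.
have mK : measurable K.
  rewrite -(setCK K); apply: measurableC; apply: open_measurable_plane.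
  by rewrite openC; apply: compact_closed => //; exact: norm_hausdorff.
have := @content_sub_fsum _ _ _ mu _ _ K V (finite_fset D)
  (fun i _ => mV i) mK KD.
by rewrite fsbig1// => i _; have [] := VP i.
Qed.

Lemma Hmax_attained (mu : {measure set (R * R)%type -> \bar R}) (w : R * R) :
  radon mu -> (0 < mu setT)%E -> compact (supp mu) ->
  exposed_face mu w !=set0 /\ (forall a, supp mu a -> dot w a <= Hmax mu w).
Proof.
move=> rmu mu0 cE.
have cdot : {within supp mu, continuous (dot w)}.
  apply: continuous_subspaceT => z.
  apply: cvgD; apply: cvgM; try exact: cvg_cst; [exact: cvg_fst|exact: cvg_snd].
have [c /set_mem Ec cmax] := compact_EVT_max (supp_neq0 rmu mu0) cE cdot.
have ub : ubound [set dot w a | a in supp mu] (dot w c).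
  by move=> _ [a Ea <-]; apply: cmax; exact/mem_set.
have HE : Hmax mu w = dot w c.
  apply/eqP; rewrite eq_le; apply/andP; split.
    by apply: ge_sup => //; exists (dot w c); exists c.
  by apply: ub_le_sup; [exists (dot w c)|exists c].
split; first by exists c.
by move=> a Ea; rewrite HE; apply: cmax; exact/mem_set.
Qed.

End facts.

(* Main.v *)
Require Import Defs.
From mathcomp Require Import all_boot all_order all_algebra.
From mathcomp Require Import all_classical all_reals all_analysis.
From mathcomp Require Import measurable_realfun ring.
Import Order.TTheory GRing.Theory Num.Theory.
Import numFieldNormedType.Exports.
Local Open Scope classical_set_scope.
Local Open Scope ring_scope.

(** With [r = exp(-s)], the monomial at [a] is [r^(-<w,a>)], and writing [<w,a>] as [Hmax - Delta]
    splits off the constant [r^(-Hmax)] and leaves [exp(-s Delta)] ([powR_monomial_Delta]);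
    integrating gives the identity. For the limit, [Delta] is nonnegative on the support and
    vanishes exactly on the exposed face, so [exp(-s Delta)] tends pointwise to the indicator of the
    face ([expR_Delta_cvg]). It is bounded by 1, which is integrable for a finite measure, so
    dominated convergence applies. *)

Lemma compact_measurable_plane {R : realType} {K : set (R * R)} :
  compact K -> measurable K.
Proof.
move=> cK; rewrite -(setCK K); apply: measurableC; apply: open_measurable_plane.
by rewrite openC; apply: compact_closed => //; exact: norm_hausdorff.
Qed.

Lemma measurable_dot {R : realType} (w : R * R) : measurable_fun setT (dot w).
Proof. by apply: measurable_funD; apply: measurable_funM. Qed.

Lemma measurable_expR_Delta {R : realType} (mu : {measure set (R * R)%type -> \bar R})
    (w : R * R) (s : R) (D : set (R * R)) :
  measurable_fun D (fun a => (expR (- (s * Delta mu w a)))%:E).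
Proof.
apply: measurable_funTS; apply/measurable_EFinP.
apply: measurableT_comp => //; apply: measurableT_comp => //.
apply: measurable_funM => //; apply: measurable_funB => //.
exact: measurable_dot.
Qed.

Lemma measurable_exposed_face {R : realType}
    (mu : {measure set (R * R)%type -> \bar R}) (w : R * R) :
  compact (supp mu) -> measurable (exposed_face mu w).
Proof.
move=> /compact_measurable_plane mE.
have -> : exposed_face mu w = supp mu `&` dot w @^-1` [set Hmax mu w] by [].
apply: measurableI => //; rewrite -[X in measurable X]setTI.
exact: measurable_dot.
Qed.

Lemma powR_monomial_Delta {R : realType}
    (mu : {measure set (R * R)%type -> \bar R}) (w a : R * R) (r : R) :
  0 < r ->
  (r `^ w.1) `^ (- a.1) * (r `^ w.2) `^ (- a.2) =
  r `^ (- Hmax mu w) * expR (- (ln (1 / r) * Delta mu w a)).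
Proof.
(* [powR] treats base 0 separately; [r > 0] selects the branch [exp(a * ln r)]. As
   [ln (1 / r) = - ln r], the [Hmax] terms in the exponent cancel. *)
move=> r0; rewrite -!powRrM /powR gt_eqF// -!expRD div1r lnV ?posrE//.
by congr expR; rewrite /Delta /dot; ring.
Qed.

(** On the face [Delta = 0] and the function is constantly 1; off the face [Delta > 0], so the
    exponent tends to minus infinity. *)
Lemma expR_Delta_cvg {R : realType}
    (mu : {measure set (R * R)%type -> \bar R}) {w a : R * R} :
  supp mu a -> dot w a <= Hmax mu w ->
  expR (- (s * Delta mu w a)) @[s --> +oo] --> (\1_(exposed_face mu w) a : R).
Proof.
move=> Ea; rewrite le_eqVlt => /predU1P[Ha|lta].
  rewrite indicE mem_set// /Delta Ha subrr.
  under eq_cvg do rewrite mulr0 oppr0 expR0.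
  exact: cvg_cst.
rewrite indicE memNset; last by move=> [_ Ha]; move: lta; rewrite Ha ltxx.
apply: (@cvg_comp _ _ _ (fun s => s * Delta mu w a) (fun x => expR (- x)));
  last exact: cvgr_expR.
by apply: gt0_cvgMly; [rewrite subr_gt0|exact: cvg_id].
Qed.

Theorem proposition3p3 (R : realType)
    (mu : {finite_measure set (R * R)%type -> \bar R})
    (mu_radon : radon mu)
    (mu_neq0 : (0 < mu setT)%E)
    (supp_compact : compact (supp mu))
    (supp_ge0 : supp mu `<=` [set a | 0 <= a.1 /\ 0 <= a.2])
    (p q : R) (p_gt0 : 0 < p) (q_gt0 : 0 < q) :
  (forall r s : R, 0 < r < 1 -> s = ln (1 / r) ->
     F0 mu (r `^ p) (r `^ q) =
       ((r `^ (- Hmax mu (p, q)))%:E * Lambda mu (p, q) s)%E) /\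
  Lambda mu (p, q) s @[s --> +oo] --> mu (exposed_face mu (p, q)).
Proof.
have mE := compact_measurable_plane supp_compact.
split=> [r _ /andP[r0 _] ->|].
  rewrite /F0 /Lambda -ge0_integralZl_EFin//.
  - apply: eq_integral => a _; rewrite -EFinM; congr EFin.
    exact: (powR_monomial_Delta mu (p, q) a r r0).
  - exact: measurable_expR_Delta.
  - exact: powR_ge0.
(* [Hub] says that [Delta] is nonnegative on the support. *)
have [_ Hub] := Hmax_attained (p, q) mu_radon mu_neq0 supp_compact.
have mF := measurable_exposed_face mu (p, q) supp_compact.
(* The limit becomes the integral of the pointwise limit, the shape that dominated convergence
   yields. *)
have <- : (\int[mu]_(a in supp mu) (\1_(exposed_face mu (p, q)) a)%:E)%E =
    mu (exposed_face mu (p, q)).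
  by rewrite integral_indic//; congr (mu _); apply/setIidPl => a [].
(* The integrand is dominated by 1 only for nonnegative parameters. *)
apply: (@cvg_trans _ (Lambda mu (p, q) `|s| @[s --> +oo])).
  apply: near_eq_cvg; near=> s; rewrite ger0_norm//.
(* Testing the limit along arbitrary sequences [u] tending to infinity gives a sequence of
   integrands. *)
apply/cvge_pinftyP => u uoo.
apply: (@dominated_cvg _ _ _ _ _ mE _ _ (cst 1%E)) => //.
- by move=> n; exact: measurable_expR_Delta.
- move=> a Ea; apply: cvg_EFin; first exact: nearW.
  apply: (@cvg_comp _ _ _ (fun n => `|u n|)
    (fun s => expR (- (s * Delta mu (p, q) a))));
    last by apply: expR_Delta_cvg => //; exact: Hub.
  (* [|u n|] diverges because it dominates [u n]. *)
  apply/cvgryPge => A; near=> n.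
  apply: le_trans (ler_norm _); near: n.
  by move/cvgryPge : uoo; exact.
- exact: finite_measure_integrable_cst.
- move=> n a Ea; rewrite gee0_abs ?lee_fin ?expR_ge0//.
  by rewrite -expR0 ler_expR oppr_le0 mulr_ge0// subr_ge0 Hub.
Unshelve. all: by end_near. Qed.
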